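(* Let $A$ and $B$ be nontrivial (additive) abelian groups, let $I$ be a set with $|I|>1$, let $\varphi_1\colon A\to B$ be a map of sets such that $\varphi_1(-a)=\varphi_1(a)$ for all $a\in A$, and let $\varphi_2\colon B\to A$ be a group homomorphism. Let $X(A,B,I)=A\times B\times I$, let $\sigma_{(a,b,i)}\in\operatorname{Sym}(X(A,B,I))$ be defined by $$\sigma_{(a,b,i)}(c,d,j)=\begin{cases}(c,d+\varphi_1(a-c),j)&\text{if } i=j,\\ (c+\varphi_2(b),d,j)&\text{if } i\neq j,\end{cases}$$ and let $r\colon X(A,B,I)^2\to X(A,B,I)^2$ be defined by $$r((a,b,i),(c,d,j))=\bigl(\sigma_{(a,b,i)}(c,d,j),\ \sigma^{-1}_{\sigma_{(a,b,i)}(c,d,j)}(a,b,i)\bigr).$$ For $i\in I$ put $X_i=A\times B\times\{i\}$. Then $(X(A,B,I),r)$ is a solution of the YBE and the following hold. (i) $(X(A,B,I),r)$ is square-free if and only if $\varphi_1(0)=0$. (ii) If $\varphi_1^{-1}(0)=\{0\}$ and $\varphi_2$ is injective, then $(X(A,B,I),r)$ is irretractable. (iii) Every $X_i$ is invariant under the action of the permutation group $\mathcal{G}(X(A,B,I),r)$, and if $r_i$ denotes the restriction of $r$ to $X_i^2$, then $(X_i,r_i)$ is a multipermutation solution of multipermutation level at most two, and $(X(A,B,I),r)$ is a strong twisted union of the solutions $(X_i,r_i)$, $i\in I$. (iv) If $\varphi_1(A)$ generates $B$ as a group and $\varphi_2$ is surjective, then the orbits for the action of $\mathcal{G}(X(A,B,I),r)$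 on $X(A,B,I)$ are the sets $X_i$, for $i\in I$.
   Context: A solution of the YBE is a pair $(X,r)$ where $X$ is a non-empty set and $r\colon X\times X\to X\times X$, written $r(x,y)=(\sigma_x(y),\gamma_y(x))$, satisfies: (1) $r^2=\mathrm{id}_{X^2}$; (2) $\sigma_x,\gamma_x\in\operatorname{Sym}(X)$ for all $x\in X$; (3) $r_{12}r_{23}r_{12}=r_{23}r_{12}r_{23}$ on $X^3$, where $r_{ij}$ acts as $r$ on the $(i,j)$ components and as the identity on the remaining one. The solution is square-free if $r(x,x)=(x,x)$ for all $x\in X$. The permutation group $\mathcal{G}(X,r)$ is the subgroup of $\operatorname{Sym}(X)$ generated by $\{\sigma_x\mid x\in X\}$, acting naturally on $X$. Retraction: define $x\sim y$ iff $\sigma_x=\sigma_y$, and let $\bar x$ be the class of $x$. $\operatorname{Ret}(X,r)$ is the solution $(\bar X,\bar r)$ with $\bar X=X/{\sim}$ and $\bar r(\bar x,\bar y)=(\overline{\sigma_x(y)},\overline{\gamma_y(x)})$. $(X,r)$ is irretractable if $\operatorname{Ret}(X,r)=(X,r)$, i.e. $\sigma_x=\sigma_y$ implies $x=y$. $(X,r)$ is a multipermutation solution if there is a positive integer $n$ such that $\operatorname{Ret}^n(X,r)$ is a solution on a set of cardinality $1$; the smallest such positive integer $n$ is its multipermutation level. Strong twisted union: a solution $(X,r)$, $r(a,b)=(\sigma_a(b),\gamma_b(a))$, is a strong twisted union of a family of solutions $\{(X_j,r_j)\mid j\in J\}$ with $|J|>1$ if the $X_j$ are $\mathcal{G}(X,r)$-invariant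 pairwise disjoint subsets of $X$ with $X=\bigcup_{j\in J}X_j$, each $r_j$ is the restriction of $r$ to $X_j^2$, and for all $j\neq k$ in $J$, all $x,y\in X_j$ and all $z,t\in X_k$: $\sigma_{\gamma_x(z)}(y)=\sigma_z(y)$ and $\gamma_{\sigma_z(x)}(t)=\gamma_x(t)$. *)

(* Defs.v *)
From HB Require Import structures.
From mathcomp Require Import all_boot all_order all_algebra generic_quotient.
From mathcomp Require Import boolp classical_sets functions.

Set Implicit Arguments.
Unset Strict Implicit.
Unset Printing Implicit Defensive.

Import GRing.Theory.

Local Open Scope classical_set_scope.
Local Open Scope ring_scope.
Local Open Scope quotient_scope.

Section Solutions.
Variables (X : choiceType) (r : X * X -> X * X).

(* r (x, y) = (sigma x y, gamma y x): the first argument of [gamma] is the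
   subscript. *)
Definition sigma (x y : X) : X := (r (x, y)).1.
Definition gamma (y x : X) : X := (r (x, y)).2.

Definition r12 (t : X * X * X) : X * X * X := (r t.1, t.2).
Definition r23 (t : X * X * X) : X * X * X :=
  let u := r (t.1.2, t.2) in (t.1.1, u.1, u.2).

Definition is_solution : Prop :=
  [/\ inhabited X,
      involutive r,
      forall x, bijective (sigma x) /\ bijective (gamma x)
    & forall t, r12 (r23 (r12 t)) = r23 (r12 (r23 t))].

Definition square_free : Prop := forall x, r (x, x) = (x, x).

Definition irretractable : Prop := forall x y, sigma x = sigma y -> x = y.

(* Subgroups of Sym(X), as sets of functions X -> X. *)
Definition sym_subgroup (G : set (X -> X)) : Prop :=
  [/\ G `<=` [set f | bijective f],
      G id,
      forall f g, G f -> G g -> G (f \o g)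
    & forall f g, G f -> cancel f g -> cancel g f -> G g].

Definition permutation_group : set (X -> X) :=
  smallest sym_subgroup (range sigma).

Definition invariant_set (D : set X) : Prop :=
  forall f x, permutation_group f -> D x -> D (f x).

Definition orbit_of (x : X) : set X := [set f x | f in permutation_group].

Definition ret_rel : rel X := fun x y => `[< sigma x = sigma y >].

Lemma ret_rel_refl : reflexive ret_rel.
Proof. by move=> x; apply/asboolP. Qed.

Lemma ret_rel_sym : symmetric ret_rel.
Proof. by move=> x y; apply/asboolP/asboolP => ->. Qed.

Lemma ret_rel_trans : transitive ret_rel.
Proof. by move=> y x z /asboolP xy /asboolP yz; apply/asboolP; rewrite xy. Qed.

Canonical ret_equiv : equiv_rel X :=
  EquivRel ret_rel ret_rel_refl ret_rel_sym ret_rel_trans.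

Definition ret_type : choiceType := {eq_quot ret_equiv}.

Definition ret_class (x : X) : ret_type := \pi_({eq_quot ret_equiv}) x.

Lemma ret_classE x y : ret_class x = ret_class y <-> sigma x = sigma y.
Proof.
split; first by move/eqquotP/asboolP.
by move=> xy; apply/eqquotP/asboolP.
Qed.

(* Computed on chosen representatives; see [ret_mapE] for the independence of
   that choice. *)
Definition ret_map (p : ret_type * ret_type) : ret_type * ret_type :=
  (ret_class (sigma (repr p.1) (repr p.2)),
   ret_class (gamma (repr p.2) (repr p.1))).

End Solutions.

Arguments ret_class {X} r x.
Arguments ret_map {X} r p.

Section RetractionIsSolution.
Variables (X : choiceType) (r : X * X -> X * X).
Hypothesis solr : is_solution r.

Local Notation sigma := (sigma r).
Local Notation gamma := (gamma r).
Local Notation ret_class := (ret_class r).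
Local Notation ret_type := (ret_type r).

Let rK : involutive r. Proof. by case: solr. Qed.
Let sigma_bij x : bijective (sigma x). Proof. by case: solr => _ _ /(_ x)[]. Qed.
Let gamma_bij x : bijective (gamma x). Proof. by case: solr => _ _ /(_ x)[]. Qed.

Let rE x y : r (x, y) = (sigma x y, gamma y x).
Proof. by rewrite /sigma /gamma; case: (r _). Qed.

Let sigma_gamma x y : sigma (sigma x y) (gamma y x) = x.
Proof. by have := rK (x, y); rewrite rE rE => -[]. Qed.

Let gamma_sigma x y : gamma (gamma y x) (sigma x y) = y.
Proof. by have := rK (x, y); rewrite rE rE => -[]. Qed.

Let braid x y z :
  [/\ sigma (sigma x y) (sigma (gamma y x) z) = sigma x (sigma y z)
    & gamma z (gamma y x) = gamma (gamma z y) (gamma (sigma y z) x)].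
Proof.
case: solr => _ _ _ /(_ (x, y, z)); rewrite /r12 /r23 /=.
by rewrite /= !rE /= => -[].
Qed.

Let gammaE u v : sigma u = sigma v -> gamma u = gamma v.
Proof.
move=> uv; have fix_inv x t : sigma x t = x -> gamma t x = t.
  by move=> xt; apply: (bij_inj (sigma_bij x)); rewrite -{1}xt sigma_gamma xt.
apply/funext => x.
have [t tx] : exists t, sigma x t = x.
  by have [g _ gK] := sigma_bij x; exists (g x).
suff diag w s : sigma (gamma w x) s = gamma w x -> sigma w s = t.
  have [s sv] : exists s, sigma (gamma v x) s = gamma v x.
    by have [g _ gK] := sigma_bij (gamma v x); exists (g (gamma v x)).
  have [q qu] : exists q, sigma (gamma u x) q = gamma u x.
    by have [g _ gK] := sigma_bij (gamma u x); exists (g (gamma u x)).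
  have sq : s = q.
    apply: (bij_inj (sigma_bij u)).
    by rewrite {1}uv (diag v s sv) (diag u q qu).
  apply: (bij_inj (gamma_bij s)).
  by rewrite (fix_inv _ _ sv) sq (fix_inv _ _ qu).
move=> ws; have [b1 _] := braid x w s.
rewrite ws sigma_gamma in b1.
by apply: (bij_inj (sigma_bij x)); rewrite -b1 tx.
Qed.

Let sigma_comp x y z :
  sigma (sigma x y) (sigma (gamma y x) z) = sigma x (sigma y z).
Proof. by case: (braid x y z). Qed.

Lemma ret_mapE x y :
  ret_map r (ret_class x, ret_class y) =
  (ret_class (sigma x y), ret_class (gamma y x)).
Proof.
have sx : sigma (repr (ret_class x)) = sigma x by apply/ret_classE/reprK.
have sy : sigma (repr (ret_class y)) = sigma y by apply/ret_classE/reprK.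
rewrite /ret_map /= sx (gammaE sy).
move: (repr (ret_class x)) (repr (ret_class y)) sx sy => x' y' sx sy.
have gs : sigma (gamma y x') = sigma (gamma y x).
  apply/funext => z; apply: (bij_inj (sigma_bij (sigma x y))).
  by rewrite sigma_comp -sx !sigma_comp.
congr pair; last exact/ret_classE.
apply/ret_classE/funext => z.
have [g _ gK] := sigma_bij (gamma y x); rewrite -[z]gK sigma_comp.
by rewrite -(gammaE sy) sigma_comp sy.
Qed.

Lemma ret_solution : is_solution (ret_map r).
Proof.
have surj q : exists x, q = ret_class x.
  by exists (repr q); rewrite /ret_class reprK.
have bijI (f : ret_type -> ret_type) (g : X -> X) : bijective g ->
    (forall y, f (ret_class y) = ret_class (g y)) ->
    (forall y z, sigma (g y) = sigma (g z) -> sigma y = sigma z) ->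
  bijective f.
  move=> [h gK hK] fE finj.
  have fh u : f (ret_class (h u)) = ret_class u by rewrite fE hK.
  exists (fun q => ret_class (h (repr q))) => q; last first.
    by rewrite fh /ret_class reprK.
  have [y ->] := surj q; rewrite fE; apply/ret_classE/finj.
  by rewrite hK; apply/ret_classE; rewrite /ret_class reprK.
split.
- by case: solr => -[x] _ _ _; exists; apply: (ret_class x).
- move=> [p q]; have [x ->] := surj p; have [y ->] := surj q.
  by rewrite !ret_mapE sigma_gamma gamma_sigma.
- move=> p; have [x ->] := surj p; split.
  + apply: (bijI _ _ (sigma_bij x)) => [y|y z yz].
      by rewrite [LHS]/Defs.sigma ret_mapE.
    have gg : gamma y x = gamma z x.
      apply: (bij_inj (sigma_bij (sigma x y))).
      by rewrite sigma_gamma yz sigma_gamma.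
    apply/funext => t; apply: (bij_inj (sigma_bij x)).
    by rewrite -(sigma_comp x y) -(sigma_comp x z) yz gg.
  + apply: (bijI _ _ (gamma_bij x)) => [y|y z yz].
      by rewrite [LHS]/Defs.gamma ret_mapE.
    have gyz := gammaE yz.
    have ss : sigma y x = sigma z x.
      apply: (bij_inj (gamma_bij (gamma x y))).
      by rewrite gamma_sigma gyz gamma_sigma.
    apply/funext => t; have [g _ gK] := sigma_bij x; rewrite -[t]gK.
    by rewrite -(sigma_comp y x) -(sigma_comp z x) ss yz.
- move: (ret_map r) ret_mapE => s sE [[p q] t].
  have [x ->] := surj p; have [y ->] := surj q; have [z ->] := surj t.
  case: solr => _ _ _ /(_ (x, y, z)); rewrite /r12 /r23 /= !rE !sE /=.
  by move=> [-> -> ->].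
Qed.

End RetractionIsSolution.

Definition is_restriction (X : choiceType) (r : X * X -> X * X)
    (D : set X) (s : D * D -> D * D) : Prop :=
  forall x y : D,
    r (val x, val y) = (val (s (x, y)).1, val (s (x, y)).2).

Lemma is_restriction_unique (X : choiceType) (r : X * X -> X * X)
    (D : set X) (s s' : D * D -> D * D) :
  is_restriction r s -> is_restriction r s' -> s = s'.
Proof.
move=> rs rs'; apply/funext => -[x y].
have := rs x y; rewrite rs'; case: (s _) (s' _) => [u v] [u' v'] /= [eu ev].
by congr pair; apply: val_inj.
Qed.

Definition strong_twisted_union (X : choiceType) (r : X * X -> X * X)
    (J : Type) (D : J -> set X) (s : forall j, D j * D j -> D j * D j) : Prop :=
  [/\ is_solution r,
      (exists j k : J, j <> k)
    & (forall j, is_solution (s j))] /\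
  [/\ (forall j, invariant_set r (D j)),
      trivIset setT D,
      \bigcup_j D j = setT,
      (forall j, is_restriction r (s j))
    & forall j k, j <> k ->
        forall x y z t, D j x -> D j y -> D k z -> D k t ->
          sigma r (gamma r x z) y = sigma r z y /\
          gamma r (sigma r z x) t = gamma r x t].

Record ybmap := YBMap {
  carrier : choiceType;
  ybm : carrier * carrier -> carrier * carrier }.

Definition Ret (S : ybmap) : ybmap := YBMap (ret_map (@ybm S)).

Definition retracts_to_point (n : nat) (S : ybmap) : Prop :=
  is_solution (@ybm (iter n Ret S)) /\
  exists x : carrier (iter n Ret S), forall y, y = x.

Definition multipermutation_level (S : ybmap) (n : nat) : Prop :=
  [/\ (0 < n)%N,
      retracts_to_point n S
    & forall m, (0 < m)%N -> retracts_to_point m S -> (n <= m)%N].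

Section Family.
Variables (A B : zmodType) (I : choiceType) (phi1 : A -> B) (phi2 : B -> A).

Definition XABI : choiceType := (A * B * I)%type.

Definition sigmaX (x y : XABI) : XABI :=
  let: (a, b, i) := x in let: (c, d, j) := y in
  if i == j then (c, d + phi1 (a - c), j) else (c + phi2 b, d, j).

Lemma sigmaX_bij x : bijective (sigmaX x).
Proof.
case: x => [[a b] i].
exists (fun y : XABI => let: (c, d, j) := y in
  if i == j then (c, d - phi1 (a - c), j) else (c - phi2 b, d, j));
  by move=> [[c d] j] /=; case: ifP => ij /=; rewrite ij ?addrK ?subrK.
Qed.

(* Makes [(sigmaX x)^-1] denote the two-sided inverse of [sigmaX x]. *)
HB.instance Definition _ x := BijTT.Build XABI XABI (sigmaX x) (sigmaX_bij x).

Definition rX (p : XABI * XABI) : XABI * XABI :=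
  (sigmaX p.1 p.2, (sigmaX (sigmaX p.1 p.2))^-1%FUN p.1).

Lemma sigma_rX x y : sigma rX x y = sigmaX x y.
Proof. by []. Qed.

Definition Xpart (i : I) : set XABI := [set x | x.2 = i].

End Family.

Definition generates (V : zmodType) (E : set V) : Prop :=
  smallest [set G : set V | GRing.zmod_closed (mem G)] E = setT.

(* Main.v *)
Require Import Defs.
From HB Require Import structures.
From mathcomp Require Import all_boot all_order all_algebra.
From mathcomp Require Import boolp classical_sets functions.

Set Implicit Arguments.
Unset Strict Implicit.
Unset Printing Implicit Defensive.

Import GRing.Theory.

Local Open Scope classical_set_scope.
Local Open Scope ring_scope.

(** The permutation sigma_(c,d,j) acts on level i in a way that depends only on
    d when i <> j and only on c when i = j.  Passing from y to sigma_x y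
    changes exactly the other coordinate, so sigma_(sigma_x y) and sigma_y take
    the same value at every point of the level of x.  Hence gamma_y is simply
    the inverse of sigma_y.  By [solution_of_inverses], being a solution then
    reduces to one identity between permutations,
    sigma_x sigma_y = sigma_(sigma_x y) sigma_(gamma_y x) ([sigmaX_comp]).
    The only delicate case is x, y on one level and z on another: the
    corrections phi1 (a - c) and - phi1 (c - a) made to the second coordinates
    of x and y must cancel under phi2, and this is where the evenness of phi1
    and the additivity of phi2 enter.

    For (ii), two elements with the same sigma have the same level because on
    its own level sigma fixes the first coordinate and moves the second by
    phi1 (a - a'), which cannot vanish for all a' as A is nontrivial; then
    phi1 recovers the first coordinate and phi2 the second.

    For (iii), an invariant subset of a solution is a solution
    ([restriction_solution]).  On X_i one has sigma_(sigma_x y) = sigma_y, so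
    all permutations of the retraction are trivial and the second retraction
    is a point ([multipermutation_level_le2]).  The union is strong twisted
    because the action of z on another level depends only on the second
    coordinate of z, which elements of that other level leave unchanged.

    For (iv), acting from another level translates the first coordinate by
    any element of phi2(B) = A.  At a fixed first coordinate, acting from the
    same level translates the second coordinate by any value of phi1, and the
    translations that stay in the orbit form a subgroup ([Xpart_orbit]). *)

(** * Solutions in general *)

Section Criterion.
Variables (X : choiceType) (s t : X -> X -> X).
Hypothesis sK : forall x, cancel (s x) (t x).
Hypothesis tK : forall x, cancel (t x) (s x).
Hypothesis t_s : forall x y, t (s x y) x = t y x.
Hypothesis s_comp : forall x y z, s x (s y z) = s (s x y) (s (t y x) z).

(** With gamma_y = t_y the inverse of sigma_y, the first component of the braid
    relation is [s_comp] and the last one is the inverse of [s_comp]; the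
    middle component follows from these two. *)
Lemma solution_of_inverses (r : X * X -> X * X) :
    inhabited X -> (forall x y, r (x, y) = (s x y, t y x)) ->
  is_solution r.
Proof.
move=> X0 rE; split=> //.
- by move=> [x y]; rewrite !rE -(t_s (s x y)) -(t_s x y) tK sK.
- move=> x; split; first by exists (t x) => y; rewrite /sigma rE /= ?sK ?tK.
  by exists (s x) => y; rewrite /gamma rE /= ?sK ?tK.
move=> [[x y] z]; rewrite /r12 /r23 /= !rE /=.
congr (_, _, _).
- by rewrite -s_comp.
- (* Both middle components are sent to [s x y] by the permutation attached
     to the first component, which is the same on both sides. *)
  apply: (can_inj (sK (s x (s y z)))).
  by rewrite -s_comp -(t_s y z) tK {1}s_comp -(t_s (s x y)) tK.
- apply: (can_inj (sK (t z y))); rewrite tK.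
  apply: (can_inj (sK (s y z))); rewrite tK.
  by rewrite -s_comp !tK.
Qed.

End Criterion.

Section Action.
Variables (X : choiceType) (r : X * X -> X * X).
Hypothesis solr : is_solution r.

Lemma sym_subgroup_permutation_group : sym_subgroup (permutation_group r).
Proof.
split.
- apply: smallest_sub => [|f [x _ <-]]; last by case: solr => _ _ /(_ x)[].
  split=> //=; first by exists id.
  + by move=> f g fb gb; apply: bij_comp.
  + by move=> f g _ fK gK; exists f.
- by move=> G [[]].
- by move=> f g Gf Gg G GG; case: (GG) => -[_ _ GM _] _; apply: GM;
    [apply: Gf | apply: Gg].
- by move=> f g Gf fK gK G GG; case: (GG) => -[_ _ _ GV] _;
    apply: GV fK gK; apply: Gf.
Qed.

Lemma permutation_group_sigma x : permutation_group r (sigma r x).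
Proof. by move=> G [_]; apply; exists x. Qed.

Lemma orbit_of_refl x : orbit_of r x x.
Proof. by exists id => //; case: sym_subgroup_permutation_group. Qed.

Lemma orbit_of_trans {x} y {z} :
  orbit_of r x y -> orbit_of r y z -> orbit_of r x z.
Proof.
case: sym_subgroup_permutation_group => _ _ GM _.
by move=> [f Gf <-] [g Gg <-]; exists (g \o f) => //; apply: GM.
Qed.

Lemma orbit_of_sym {x y} : orbit_of r x y -> orbit_of r y x.
Proof.
case: sym_subgroup_permutation_group => Gbij _ _ GV [f Gf <-].
have [g fK gK] := Gbij _ Gf.
by exists g; rewrite ?fK //; apply: GV fK gK.
Qed.

Lemma orbit_of_sigma x y : orbit_of r y (sigma r x y).
Proof. by exists (sigma r x) => //; apply: permutation_group_sigma. Qed.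

(** Invariance only has to be tested on the generators. *)
Lemma invariant_set_of_sigma (D : set X) :
  (forall x y, D (sigma r x y) <-> D y) -> invariant_set r D.
Proof.
(* Stability in both directions is what makes the stabilizer closed under
   inverses. *)
move=> DE f x Gf; suff : bijective f /\ (forall y, D (f y) <-> D y).
  by move=> [_ fD] /fD.
apply: (Gf [set f : X -> X | bijective f /\ forall y, D (f y) <-> D y]).
split; last by move=> _ [y _ <-]; split=> //; case: solr => _ _ /(_ y)[].
split=> [g []//||g h [gb gD] [hb hD]|g h [gb gD] gK hK].
- by split=> //; exists id.
- by split=> [|y]; [exact: bij_comp | rewrite -(hD y) -(gD (h y))].
- by split=> [|y]; [exists g | rewrite -(gD (h y)) hK].
Qed.

Section Restriction.
Variable D : set X.
Hypothesis D0 : D !=set0.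
Hypothesis DG : invariant_set r D.

Let rE x y : r (x, y) = (sigma r x y, gamma r y x).
Proof. by rewrite /sigma /gamma; case: (r _). Qed.

Let rK : involutive r. Proof. by case: solr. Qed.

Let sigma_bij x : bijective (sigma r x).
Proof. by case: solr => _ _ /(_ x)[]. Qed.

Let gamma_bij x : bijective (gamma r x).
Proof. by case: solr => _ _ /(_ x)[]. Qed.

Let sigma_gamma x y : sigma r (sigma r x y) (gamma r y x) = x.
Proof. by have := rK (x, y); rewrite !rE => -[]. Qed.

Lemma invariant_sigma x y : D (sigma r x y) <-> D y.
Proof.
split; last by apply: DG; apply: permutation_group_sigma.
have /orbit_of_sym[f Gf {2}<-] := orbit_of_sigma x y.
exact: DG.
Qed.

(** Although gamma need not lie in the permutation group, it preserves D because
    gamma_x y is the preimage of y under a sigma. *)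
Lemma invariant_gamma x y : D (gamma r x y) <-> D y.
Proof. by rewrite -(invariant_sigma (sigma r y x)) sigma_gamma. Qed.

Lemma restriction_exists : exists s : D * D -> D * D, is_restriction r s.
Proof.
have Ds (x y : D) : sigma r (val x) (val y) \in D.
  by apply: mem_set; apply/invariant_sigma; apply: set_valP.
have Dg (x y : D) : gamma r (val x) (val y) \in D.
  by apply: mem_set; apply/invariant_gamma; apply: set_valP.
by exists (fun p => (SigSub (Ds p.1 p.2), SigSub (Dg p.2 p.1))) => x y /=.
Qed.

Lemma restriction_solution (s : D * D -> D * D) :
  is_restriction r s -> is_solution s.
Proof.
move=> rs; have sE (p : D * D) :
    r (val p.1, val p.2) = (val (s p).1, val (s p).2).
  by case: p => x y; apply: rs.
have sval x y : val (sigma s x y) = sigma r (val x) (val y).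
  by rewrite /sigma rs.
have gval x y : val (gamma s x y) = gamma r (val x) (val y).
  by rewrite /gamma rs.
have bijD (f : X -> X) (g : D -> D) : bijective f ->
    (forall y, D (f y) <-> D y) -> (forall y, val (g y) = f (val y)) ->
  bijective g.
  move=> [h fK hK] fD gE.
  have Dh (y : D) : h (val y) \in D.
    by apply: mem_set; apply/fD; rewrite hK; apply: set_valP.
  by exists (fun y => SigSub (Dh y)) => y; apply: val_inj => /=;
    rewrite gE /= ?fK ?hK.
split.
- by have [x Dx] := D0; exists; apply: (SigSub (mem_set Dx)).
- move=> [x y]; have := rK (val x, val y); rewrite rs sE.
  by case: (s (s _)) => u v /= [/val_inj-> /val_inj->].
- move=> x; split.
    by apply: (bijD (sigma r (val x))) => // y; apply: invariant_sigma.
  by apply: (bijD (gamma r (val x))) => // y; apply: invariant_gamma.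
- pose V (u : D * D * D) := (val u.1.1, val u.1.2, val u.2).
  have V_inj : injective V.
    by move=> [[x y] z] [[x' y'] z'] [/val_inj-> /val_inj-> /val_inj->].
  have V12 u : V (r12 s u) = r12 r (V u).
    by case: u => [[x y] z]; rewrite /V /r12 /= rs.
  have V23 u : V (r23 s u) = r23 r (V u).
    by case: u => [[x y] z]; rewrite /V /r23 /= rs.
  by move=> u; apply: V_inj; rewrite !(V12, V23); case: solr.
Qed.

End Restriction.

(** The hypothesis says that sigma_x y and y have the same class, so every
    permutation of the retraction is the identity and all its points are
    identified by the next retraction.  The level is 1 or 2 according to
    whether the first retraction is already a point. *)
Lemma multipermutation_level_le2 :
    (forall x y, sigma r (sigma r x y) = sigma r y) ->
  exists n, multipermutation_level (YBMap r) n /\ (n <= 2)%N.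
Proof.
move=> ss; have sol1 := ret_solution solr.
have triv (p q : ret_type r) : sigma (ret_map r) p q = q.
  rewrite -[p]reprK -[q]reprK /sigma.
  rewrite (ret_mapE solr (repr p) (repr q)) /=.
  exact/ret_classE.
have pt2 : retracts_to_point 2 (YBMap r).
  split; first exact: ret_solution.
  have [x] : inhabited X by case: solr.
  exists (ret_class (ret_map r) (ret_class r x)) => y.
  rewrite -[y]reprK; apply/ret_classE/funext => q.
  by rewrite !triv.
have [pt1|npt1] := pselect (retracts_to_point 1 (YBMap r)).
  by exists 1%N.
by exists 2%N; split=> //; split=> // -[|[|m]].
Qed.

End Action.

(** * The family X(A, B, I) *)

Section Family.
Variables (A B : zmodType) (I : choiceType) (phi1 : A -> B).
Variable phi2 : {additive B -> A}.
Hypothesis phi1N : forall a : A, phi1 (- a) = phi1 a.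

Local Notation X := (XABI A B I).
Local Notation sg := (@sigmaX A B I phi1 phi2).
Local Notation r := (@rX A B I phi1 phi2).

Definition sigmaX_inv (x y : X) : X :=
  let: (a, b, i) := x in let: (c, d, j) := y in
  if i == j then (c, d - phi1 (a - c), j) else (c - phi2 b, d, j).

Lemma sigmaXK x : cancel (sg x) (sigmaX_inv x).
Proof.
by case: x => [[a b] i] [[c d] j] /=; case: ifP => ij /=; rewrite ij addrK.
Qed.

Lemma sigmaX_invK x : cancel (sigmaX_inv x) (sg x).
Proof.
by case: x => [[a b] i] [[c d] j] /=; case: ifP => ij /=; rewrite ij subrK.
Qed.

(** At a point x, the permutation of sigma_x y is the permutation of y: the
    coordinate of y that x changes is not the one that acts on x. *)
Lemma sigmaX_inv_sigmaX x y : sigmaX_inv (sg x y) x = sigmaX_inv y x.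
Proof.
case: x y => [[a b] i] [[c d] j] /=.
by have [->|nij] := eqVneq i j; rewrite /= ?eqxx // eq_sym (negPf nij).
Qed.

Lemma rXE x y : r (x, y) = (sg x y, sigmaX_inv y x).
Proof.
rewrite /rX /= -(sigmaX_inv_sigmaX x y); congr (_, _).
by apply: (can_inj (sigmaXK (sg x y))); rewrite sigmaX_invK invK ?inE.
Qed.

Lemma sigmaX_comp x y z : sg x (sg y z) = sg (sg x y) (sg (sigmaX_inv y x) z).
Proof.
case: x y z => [[a b] i] [[c d] j] [[e f] k] /=.
have [->|nij] := eqVneq i j; have [<-|njk] := eqVneq j k.
- by rewrite /= !eqxx addrAC.
- (* x and y on one level, z on another: the two corrections cancel since
     phi1 is even. *)
  rewrite /= (negPf njk) /= (negPf njk) -!addrA -!raddfD /= -(opprB a c) phi1N.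
  by rewrite addrACA addNr addr0 [b + d]addrC.
- by rewrite /= (negPf nij) eqxx opprD addrACA subrr addr0.
- have [<-|nik] := eqVneq i k.
    by rewrite /= eqxx [j == i]eq_sym (negPf nij) /= opprD addrA addrAC.
  by rewrite /= (negPf nik) (negPf njk) addrAC.
Qed.

Lemma gamma_rX x y : gamma r x y = sigmaX_inv x y.
Proof. by rewrite /gamma rXE. Qed.

Lemma rX_solution : inhabited I -> is_solution r.
Proof.
move=> [i]; apply: (solution_of_inverses sigmaXK sigmaX_invK) rXE.
- exact: sigmaX_inv_sigmaX.
- exact: sigmaX_comp.
- by exists; apply: (0, 0, i).
Qed.

Lemma rX_square_free : inhabited I -> square_free r <-> phi1 0 = 0.
Proof.
move=> [i]; split=> [/(_ (0, 0, i))|phi0 [[a b] j]].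
  by rewrite rXE /= eqxx !subrr add0r => -[].
by rewrite rXE /= eqxx subrr phi0 addr0 subr0.
Qed.

Lemma rX_irretractable :
    (exists a : A, a != 0) -> (exists i j : I, i != j) ->
    phi1 @^-1` [set 0] = [set 0] -> injective phi2 ->
  irretractable r.
Proof.
move=> [a0 a0N0] [i1 [i2 i12]] phi1_0 phi2_inj.
have phi1_eq0 a : phi1 a = 0 <-> a = 0.
  by have -> : (phi1 a = 0) = (phi1 @^-1` [set 0]) a by []; rewrite phi1_0.
move=> [[a b] i] [[c d] j] E.
have {}E z : sg (a, b, i) z = sg (c, d, j) z.
  exact: (congr1 (fun f : X -> X => f z) E).
have eij : i = j.
  apply/eqP/negPn/negP => nij; move: a0N0.
  have shift e : a - e = 0.
    move: (E (e, 0, i)); rewrite /= eqxx eq_sym (negPf nij) add0r.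
    by case=> _ /phi1_eq0.
  by rewrite -(shift (a - a0)) subKr eqxx.
move: E; rewrite -{}eij => E.
have -> : a = c.
  (* Evaluating at first coordinate c makes the right-hand shift phi1 0 = 0. *)
  move: (E (c, 0, i)); rewrite /= eqxx !add0r subrr => -[].
  by rewrite (proj2 (phi1_eq0 0)) // => /phi1_eq0/subr0_eq.
(* The permutations attached to level i reveal b only on another level. *)
have [k nik] : exists k, i != k.
  by have [->|] := eqVneq i i1; [exists i2 | exists i1].
move: (E (0, 0, k)); rewrite /= (negPf nik) !add0r => -[].
by move/phi2_inj->.
Qed.

Lemma Xpart_sigmaX i x y : Xpart i (sg x y) <-> Xpart i y.
Proof. by case: x y => [[a b] k] [[c d] j]; rewrite /Xpart /=; case: ifP. Qed.

Lemma Xpart_sigma_sigma (i : I) (x y z : X) :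
    Xpart i x -> Xpart i y -> Xpart i z ->
  sg (sg x y) z = sg y z.
Proof.
case: x y z => [[a b] j] [[c d] k] [[e f] l]; rewrite /Xpart /= => -> -> ->.
by rewrite !eqxx /= eqxx.
Qed.

(** The first coordinate is corrected before the second, since phi1 acts on the
    second one through the difference of first coordinates. *)
Lemma Xpart_orbit (x : X) :
    is_solution r -> (exists i j : I, i != j) ->
    generates (range phi1) -> range phi2 = setT ->
  Xpart x.2 `<=` orbit_of r x.
Proof.
move=> solr [i1 [i2 i12]] phi1_gen phi2_surj.
case: x => [[c d] j] [[c' d'] j']; rewrite /Xpart /= => ->.
have [k nkj] : exists k, k != j.
  by have [<-|] := eqVneq i1 j; [exists i2; rewrite eq_sym | exists i1].
have moveA e : orbit_of r (e, d, j) (c', d, j).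
  have [b _ phi2b] : range phi2 (c' - e) by rewrite phi2_surj.
  have := orbit_of_sigma r (0, b, k) (e, d, j).
  by rewrite sigma_rX /= (negPf nkj) phi2b subrKC.
(* Translations of the second coordinate at a fixed first one form a
   subgroup of [B]. *)
pose H : set B := [set e | forall f, orbit_of r (c', f, j) (c', f + e, j)].
have HB : H = setT.
  apply/seteqP; split=> // e _; suff : setT e.
    rewrite -[setT]phi1_gen; apply; split.
      split=> [|u v /set_mem Hu /set_mem Hv]; apply/mem_set => f.
        by rewrite addr0; apply: orbit_of_refl.
      apply: (orbit_of_trans solr (Hu f)); apply: orbit_of_sym => //.
      by have := Hv (f + (u - v)); rewrite -addrA subrK.
    move=> _ [a _ <-] f; have := orbit_of_sigma r (c' + a, 0, j) (c', f, j).
    by rewrite sigma_rX /= eqxx addrAC subrr add0r.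
  by [].
apply: orbit_of_trans (moveA c) _ => //.
have : H (d' - d) by rewrite HB.
by move/(_ d); rewrite subrKC.
Qed.

End Family.

Theorem theorem3p3 (A B : zmodType) (I : choiceType)
    (phi1 : A -> B) (phi2 : {additive B -> A})
    (A_nontrivial : exists a : A, a != 0)
    (B_nontrivial : exists b : B, b != 0)
    (I_gt1 : exists i j : I, i != j)
    (phi1N : forall a : A, phi1 (- a) = phi1 a) :
  let r := @rX A B I phi1 phi2 in
  is_solution r /\
  [/\ square_free r <-> phi1 0 = 0,
      phi1 @^-1` [set 0] = [set 0] -> injective phi2 -> irretractable r,
      (forall i : I, invariant_set r (@Xpart A B I i)) /\
      (exists s : forall i : I,
          @Xpart A B I i * @Xpart A B I i -> @Xpart A B I i * @Xpart A B I i,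
        [/\ forall i, is_restriction r (s i),
            forall i, is_solution (s i) /\
              (exists n : nat,
                 multipermutation_level (YBMap (s i)) n /\ (n <= 2)%N)
          & strong_twisted_union r s])
    & generates (range phi1) -> range phi2 = setT ->
      range (orbit_of r) = range (@Xpart A B I)].
Proof.
move=> r; have [i0 [j0 ij0]] := I_gt1.
have solr : is_solution r by apply: rX_solution => //; exists.
have inv i : invariant_set r (@Xpart A B I i).
  by apply: invariant_set_of_sigma => // x y; apply: Xpart_sigmaX.
split=> //; split.
- by apply: rX_square_free; exists.
- exact: rX_irretractable.
- split=> //.
  have [s rs] : exists s : forall i, @Xpart A B I i * @Xpart A B I i ->
      @Xpart A B I i * @Xpart A B I i, forall i, is_restriction r (s i).
    have ex i := cid (restriction_exists solr (inv i)).
    by exists (fun i => projT1 (ex i)) => i; apply: projT2.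
  have sols i : is_solution (s i).
    by apply: restriction_solution (rs i) => //; exists (0, 0, i).
  exists s; split=> // [i|].
    split=> //; apply: multipermutation_level_le2 => // x y.
    have sval u v : val (sigma (s i) u v) = sigmaX phi1 phi2 (val u) (val v).
      by rewrite -sigma_rX /sigma -/r rs.
    apply/funext => z; apply: val_inj; rewrite !sval.
    by apply: (@Xpart_sigma_sigma _ _ _ _ _ i); apply: set_valP.
  split; split=> //.
  + by exists i0, j0; apply/eqP.
  + by move=> i j _ _ [x [<- <-]].
  + by apply/seteqP; split=> // x _; exists x.2.
  + move=> j k jk x y z t; rewrite /Xpart.
    case: x y z t => [[a1 b1] l1] [[a2 b2] l2] [[a3 b3] l3] [[a4 b4] l4] /=.
    move=> -> -> -> -> {l1 l2 l3 l4}; have /negPf nkj : k != j.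
      by apply/eqP => kj; apply: jk.
    rewrite !gamma_rX !sigma_rX /= [j == k]eq_sym !nkj /= nkj.
    by rewrite [j == k]eq_sym nkj.
- move=> gen surj.
  have orbE x : orbit_of r x = Xpart x.2.
    apply/seteqP; split=> [_ [f Gf <-]|]; first exact: (inv x.2 f x Gf).
    exact: Xpart_orbit.
  apply/seteqP; split=> _ [x _ <-].
    by exists x.2; rewrite ?orbE.
  by exists (0, 0, x); rewrite ?orbE.
Qed.
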